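(* For the $T^2$-action on the nearly Kähler flag manifold $F_{1,2}(\mathbb{C}^3)=\mathrm{SU}(3)/T^2$ with multi-moment map $\nu_{F_{1,2}(\mathbb{C}^3)}$ described in the context, there are exactly two $T^2$-orbits of critical points where $\nu_{F_{1,2}(\mathbb{C}^3)}$ does not vanish. Thus they give the maximum and minimum of $\nu_{F_{1,2}(\mathbb{C}^3)}$.
   Context: $F_{1,2}(\mathbb{C}^3)$ is the manifold of pairs $(L,\Pi)$ of complex subspaces of $\mathbb{C}^3$ with $\dim L=1$, $\dim\Pi=2$, $L\subset\Pi$; it is diffeomorphic to $\mathrm{SU}(3)/T^2$, where $T^2$ is the diagonal maximal torus. Nearly Kähler structure: write $\mathfrak{su}(3)=\mathfrak{t}^2\oplus\mathfrak{m}$, with $\mathfrak{m}$ the matrices with zero diagonal. On $\mathfrak{m}$ put $g_0(X,Y)=\mathrm{Re}\,\tfrac12\mathrm{Tr}(\overline{X}^{t}Y)$ and $J_0X=\tfrac{2}{\sqrt3}\bigl(AXA^{-1}+\tfrac12X\bigr)$ with $A=\mathrm{diag}(e^{2\pi i/3},e^{4\pi i/3},1)$, and $\sigma_0=g_0(J_0\cdot,\cdot)$; these are extended by left translation to $\mathrm{SU}(3)$-invariant tensors $g,J,\sigma$ on $\mathrm{SU}(3)/T^2$. The torus $T^2=\{\mathrm{diag}(e^{i\vartheta},e^{i\varphi},e^{-i(\vartheta+\varphi)})\}\subset\mathrm{SU}(3)$ acts on $\mathrm{SU}(3)/T^2$ by left multiplication. With the basis $U=\mathrm{diag}(-i,2i,-i)$,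 $V=\mathrm{diag}(-i,-i,2i)$ of its Lie algebra, the multi-moment map at the coset of $p=(p_{ij})\in\mathrm{SU}(3)$ is $\nu_{F_{1,2}(\mathbb{C}^3)}(p)=\sigma_0\bigl((p^{-1}Up)_{\mathfrak{m}},(p^{-1}Vp)_{\mathfrak{m}}\bigr)$, where the subscript $\mathfrak{m}$ denotes projection onto $\mathfrak{m}$. It is a $T^2$-invariant smooth function and equals $-27\,\mathrm{Im}(p_{22}\overline{p}_{23}\overline{p}_{32}p_{33})$. A point is critical if $d\nu_{F_{1,2}(\mathbb{C}^3)}$ vanishes there. *)

(* Defs.v *)
From HB Require Import structures.
From mathcomp Require Import all_boot all_order all_algebra.
From mathcomp Require Import spectral sesquilinear complex generic_quotient.
From mathcomp Require Import all_classical all_reals all_analysis.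
Set Implicit Arguments.
Unset Strict Implicit.
Unset Printing Implicit Defensive.
Import Order.TTheory GRing.Theory Num.Theory.
Import numFieldNormedType.Exports.
Local Open Scope classical_set_scope.
Local Open Scope ring_scope.
Local Open Scope complex_scope.
Local Open Scope sesquilinear_scope.
Local Open Scope quotient_scope.

Definition cexpi (R : realType) (x : R) : R[i] := cos x +i* sin x.

Definition diag3 (R : realType) (a b c : R[i]) : 'M[R[i]]_3 :=
  diag_mx (\row_j [:: a; b; c]`_j).

Section SpecialUnitary.
Variable R : realType.
Implicit Types M N : 'M[R[i]]_3.

Definition su3_pred : pred 'M[R[i]]_3 :=
  fun M => (M \is unitarymx) && (\det M == 1).

Record SU3 : Type := MkSU3 { su3_val :> 'M[R[i]]_3; _ : su3_pred su3_val }.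
HB.instance Definition _ := [isSub for su3_val].
HB.instance Definition _ := [Choice of SU3 by <:].

Lemma su3_pred1 : su3_pred 1%:M.
Proof.
rewrite /su3_pred det1 eqxx andbT; apply/unitarymxP.
by rewrite trmx1 map_mx1 mulmx1.
Qed.

Lemma su3_predM M N : su3_pred M -> su3_pred N -> su3_pred (M *m N).
Proof.
case/andP=> uM /eqP dM /andP[uN /eqP dN]; rewrite /su3_pred mul_unitarymx //=.
by rewrite det_mulmx dM dN mulr1.
Qed.

Lemma su3_predV M : su3_pred M -> su3_pred (M ^t*).
Proof.
case/andP=> uM /eqP dM; apply/andP; split; first by rewrite trmxC_unitary.
by rewrite det_map_mx det_tr dM rmorph1.
Qed.

Definition su3_one : SU3 := MkSU3 su3_pred1.
Definition su3_mul (p q : SU3) : SU3 :=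
  MkSU3 (su3_predM (valP p) (valP q)).
Definition su3_inv (p : SU3) : SU3 :=
  MkSU3 (su3_predV (valP p)).

Lemma su3_mulA : associative su3_mul.
Proof. by move=> p q r; apply/val_inj; rewrite /= mulmxA. Qed.
Lemma su3_mul1 : left_id su3_one su3_mul.
Proof. by move=> p; apply/val_inj; rewrite /= mul1mx. Qed.
Lemma su3_mulr1 : right_id su3_one su3_mul.
Proof. by move=> p; apply/val_inj; rewrite /= mulmx1. Qed.
Lemma su3_mulrV : right_inverse su3_one su3_inv su3_mul.
Proof.
move=> p; apply/val_inj => /=; apply/unitarymxP.
by have /andP[] := valP p.
Qed.
Lemma su3_mulV : left_inverse su3_one su3_inv su3_mul.
Proof.
by move=> p; apply/val_inj => /=; apply: mulmx1C; exact: (congr1 su3_val (su3_mulrV p)).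
Qed.

HB.instance Definition _ := isGroup.Build SU3
  su3_mulA su3_mul1 su3_mulr1 su3_mulV su3_mulrV.

Definition torus : set SU3 := [set t | exists x y : R,
  t = diag3 (cexpi x) (cexpi y) (cexpi (- (x + y))) :> 'M[R[i]]_3].

Lemma torus1 : torus 1%g.
Proof.
exists 0, 0 => /=; apply/matrixP => i j; rewrite !mxE addr0 oppr0 /cexpi cos0 sin0.
by case: i => [[|[|[|//]]] ?].
Qed.

Lemma cexpiD (x y : R) : cexpi (x + y) = cexpi x * cexpi y.
Proof. by rewrite /cexpi cosD sinD; simpc; rewrite [_ * sin y + _]addrC. Qed.

Lemma torusM (s t : SU3) : torus s -> torus t -> torus (s * t)%g.
Proof.
move=> [x [y es]] [x' [y' et]]; exists (x + x'), (y + y').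
rewrite (_ : su3_val (s * t)%g = s *m t) // es et mulmx_diag.
congr diag_mx; apply/rowP => -[[|[|[|//]]] ?]; rewrite !mxE /= -cexpiD //.
by congr cexpi; rewrite -opprD addrACA.
Qed.

Lemma torusV (t : SU3) : torus t -> torus (t^-1)%g.
Proof.
move=> [x [y et]]; exists (- x), (- y).
rewrite (_ : su3_val (t^-1)%g = t ^t*) // et tr_diag_mx map_diag_mx.
congr diag_mx; apply/rowP => -[[|[|[|//]]] ?];
  by rewrite !mxE /= /cexpi !(cosN, sinN) ?opprK -?opprD ?(cosN, sinN).
Qed.

Definition same_coset : rel SU3 := fun p q => `[< torus (p^-1 * q)%g >].

Lemma same_coset_refl : reflexive same_coset.
Proof. by move=> p; apply/asboolP; rewrite mulVg; exact: torus1. Qed.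

Lemma same_coset_sym : symmetric same_coset.
Proof.
move=> p q; apply/asboolP/asboolP => /torusV; by rewrite invgM invgK.
Qed.

Lemma same_coset_trans : transitive same_coset.
Proof.
move=> q p r /asboolP pq /asboolP qr; apply/asboolP.
by rewrite -[r](mulVKg q) mulgA; exact: torusM.
Qed.

Definition same_coset_equiv :=
  EquivRel same_coset same_coset_refl same_coset_sym same_coset_trans.

(* F_{1,2}(C^3) as the space SU(3)/T^2 of left cosets p T^2. *)
Definition flag : Type := {eq_quot same_coset_equiv}.
HB.instance Definition _ := Choice.on flag.
HB.instance Definition _ := Quotient.on flag.
HB.instance Definition _ := EqQuotient.on flag.

Definition flag_act (t : SU3) (x : flag) : flag := \pi_flag (t * repr x)%g.

Lemma flag_act_pi (t p : SU3) : flag_act t (\pi_flag p) = \pi_flag (t * p)%g.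
Proof.
apply/eqmodP/asboolP; rewrite invgM -mulgA mulKg.
have /eqmodP/asboolP // : repr (\pi_flag p) = p %[mod flag].
by rewrite reprK.
Qed.

Definition torus_orbit (x : flag) : set flag := [set flag_act t x | t in torus].

(* On su(3) this is the projection onto the zero-diagonal matrices m along
   the diagonal ones. The formulas for g0, J0 and sigma0 make sense for all
   matrices, but they are only applied to elements of m. *)
Definition proj_m (X : 'M[R[i]]_3) : 'M[R[i]]_3 :=
  \matrix_(i, j) if i == j then 0 else X i j.

Definition g0 (X Y : 'M[R[i]]_3) : R := complex.Re (2^-1 * \tr (X ^t* *m Y)).

Definition A0 : 'M[R[i]]_3 := diag3 (cexpi (2 * pi / 3)) (cexpi (4 * pi / 3)) 1.

Definition J0 (X : 'M[R[i]]_3) : 'M[R[i]]_3 :=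
  (2 / Num.sqrt 3)%:C *: (A0 *m X *m invmx A0 + 2^-1 *: X).

Definition sigma0 (X Y : 'M[R[i]]_3) : R := g0 (J0 X) Y.

Definition basisU : 'M[R[i]]_3 := diag3 (- 'i) (2 * 'i) (- 'i).
Definition basisV : 'M[R[i]]_3 := diag3 (- 'i) (- 'i) (2 * 'i).

Definition su3_nu (p : SU3) : R :=
  sigma0 (proj_m (invmx p *m basisU *m p)) (proj_m (invmx p *m basisV *m p)).

Lemma proj_mJ (t : SU3) (X : 'M[R[i]]_3) : torus t ->
  proj_m (invmx t *m X *m t) = invmx t *m proj_m X *m t.
Proof.
move=> [x [y et]].
have -> : invmx t = t ^t*.
  by have /andP[/invmx_unitary] := valP t.
rewrite et tr_diag_mx map_diag_mx /diag3; apply/matrixP => i j.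
rewrite !mul_mx_diag !mul_diag_mx !mxE.
by case: eqP => // _; rewrite mulr0 mul0r.
Qed.

Lemma sigma0J (t : SU3) (X Y : 'M[R[i]]_3) : torus t ->
  sigma0 (invmx t *m X *m t) (invmx t *m Y *m t) = sigma0 X Y.
Proof.
move=> [x [y et]].
have ut : su3_val t \is unitarymx by have /andP[] := valP t.
have tu : su3_val t \in unitmx by exact: unitarymx_unit.
have AC : A0 \in unitmx.
  rewrite unitmxE /A0 /diag3 det_diag 3!big_ord_recl big_ord0 !mxE /= !mulr1 unitfE.
  have nz z : cexpi z != 0 :> R[i].
    apply/eqP => z0; have := cexpiD z (- z); rewrite z0 mul0r subrr /cexpi cos0.
    by move=> [] /eqP; rewrite oner_eq0.
  by rewrite mulf_neq0.
have comA : A0 *m t = t *m A0 by rewrite et /A0 /diag3 diag_mxC.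
have comAV : A0 *m invmx t = invmx t *m A0.
  by rewrite -[LHS]mul1mx -(mulVmx tu) -mulmxA (mulmxA _ A0) -comA mulmxK.
have comVA : t *m invmx A0 = invmx A0 *m t.
  by rewrite -[LHS]mul1mx -(mulVmx AC) -mulmxA (mulmxA A0) comA mulmxK.
have JJ : J0 (invmx t *m X *m t) = invmx t *m J0 X *m t.
  rewrite /J0 -scalemxAr -scalemxAl mulmxDr mulmxDl; congr (_ *: (_ + _)).
    by rewrite !mulmxA comAV -!mulmxA comVA.
  by rewrite -scalemxAr -scalemxAl.
rewrite /sigma0 JJ /g0; congr complex.Re; congr (_ * _).
rewrite !trmx_mul !map_mxM /= (invmx_unitary ut) trmxCK -(invmx_unitary ut).
by rewrite !mulmxA mulmxK // -!mulmxA mxtrace_mulC -!mulmxA mulmxV // mulmx1.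
Qed.

Definition flag_nu (x : flag) : R := su3_nu (repr x).

Lemma flag_nu_pi (p : SU3) : flag_nu (\pi_flag p) = su3_nu p.
Proof.
rewrite /flag_nu; set q := repr _.
have : torus (p^-1 * q)%g.
  have /eqmodP/asboolP // : p = q %[mod flag] by rewrite reprK.
move: (p^-1 * q)%g (mulVKg p q) => t <- tt.
have iu (r : SU3) : invmx r = r ^t*.
  by apply: invmx_unitary; have /andP[] := valP r.
have E X : invmx (p * t)%g *m X *m (p * t)%g
    = invmx t *m (invmx p *m X *m p) *m t.
  rewrite !iu (_ : su3_val (p * t)%g = p *m t) //.
  by rewrite trmx_mul map_mxM !mulmxA.
by rewrite /su3_nu !E !(proj_mJ _ tt) sigma0J.
Qed.

(* The projection onto [flag] is a submersion, so the tangent vectors at [x]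
   are the velocities of the images of curves in SU(3), and [flag_nu] has zero
   differential at [x] iff its derivative along all of them is zero. *)
Definition critical (x : flag) : Prop :=
  forall gamma : R -> SU3,
    (forall i j, derivable (fun s : R => complex.Re (gamma s i j)) 0 1 /\
                 derivable (fun s : R => complex.Im (gamma s i j)) 0 1) ->
    \pi_flag (gamma 0) = x ->
    is_derive (0 : R) 1 (fun s : R => flag_nu (\pi_flag (gamma s))) 0.

End SpecialUnitary.

(* Main.v *)
(* Put z_j = p_kj conj(p_(k+1)j), with row and column indices in Z/3.  The z_j
   sum to zero, and nu is -27 times J = Im(z_1 conj(z_2)), which does not depend
   on k.  Rotating the rows k and k+1 by an angle s, in a real and in an imaginary
   direction, adds s d_j + O(s^2), respectively i s d_j + O(s^2), to z_j, where
   d_j = |p_(k+1)j|^2 - |p_kj|^2.  At a critical point this forces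
   d_1 z_2 = d_2 z_1, hence d = 0 as soon as J <> 0 makes z_1 and z_2 independent
   over R.  So all entries have the same modulus 1/sqrt 3.

   Since |J| is twice the area of the triangle with sides |z_j|, whose perimeter
   is at most 1 by Cauchy-Schwarz, Heron's formula and AM-GM give
   108 J^2 <= 1, with equality when all moduli are equal: the critical points
   with J <> 0 are exactly the points where nu = 3 sqrt 3 / 2 or - 3 sqrt 3 / 2.

   When all moduli are equal the triangle is equilateral, so J determines the
   ratios of the z_j, and two such matrices with the same J differ only by phases
   of the rows and of the columns, that is by the two torus actions. *)

Require Import Defs.
From mathcomp Require Import all_boot all_order all_algebra.
From mathcomp Require Import spectral sesquilinear complex generic_quotient.
From mathcomp Require Import all_classical all_reals all_analysis.
From mathcomp Require Import ring lra.
Import Order.TTheory GRing.Theory Num.Theory.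
Import numFieldNormedType.Exports.
Local Open Scope classical_set_scope.
Local Open Scope ring_scope.
Local Open Scope complex_scope.
Local Open Scope sesquilinear_scope.
Local Open Scope quotient_scope.

Local Notation Re := complex.Re.
Local Notation Im := complex.Im.

(** * Complex numbers and triangles *)

Section ComplexTriangles.
Context {R : realType}.
Implicit Types z w : R[i].

Lemma complex_ext z w : Re z = Re w -> Im z = Im w -> z = w.
Proof. by case: z w => a b [c d] /= -> ->. Qed.

Lemma Re_mul z w : Re (z * w) = Re z * Re w - Im z * Im w.
Proof. by case: z w => a b [c d]. Qed.

Lemma Im_mul z w : Im (z * w) = Re z * Im w + Im z * Re w.
Proof. by case: z w => a b [c d]. Qed.

Lemma Re_conj z : Re (Num.conj z) = Re z. Proof. by case: z. Qed.
Lemma Im_conj z : Im (Num.conj z) = - Im z. Proof. by case: z. Qed.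

Lemma Re_add z w : Re (z + w) = Re z + Re w. Proof. by case: z w => a b [c d]. Qed.
Lemma Im_add z w : Im (z + w) = Im z + Im w. Proof. by case: z w => a b [c d]. Qed.
Lemma Re_opp z : Re (- z) = - Re z. Proof. by case: z. Qed.
Lemma Im_opp z : Im (- z) = - Im z. Proof. by case: z. Qed.
Definition ReImE := (Re_add, Im_add, Re_opp, Im_opp, Re_mul, Im_mul, Re_conj, Im_conj).

Definition sqnorm z : R := Re z ^+ 2 + Im z ^+ 2.
Lemma sqnorm_ge0 z : 0 <= sqnorm z. Proof. by rewrite addr_ge0 ?sqr_ge0. Qed.
Lemma sqnormM z w : sqnorm (z * w) = sqnorm z * sqnorm w.
Proof. rewrite /sqnorm !ReImE; ring. Qed.
Lemma sqnormJ z : sqnorm (Num.conj z) = sqnorm z.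
Proof. rewrite /sqnorm !ReImE; ring. Qed.
Lemma mulJ_sqnorm z : z * Num.conj z = (sqnorm z)%:C.
Proof. by apply: complex_ext; rewrite /sqnorm !ReImE /=; ring. Qed.

Lemma cexpi_surj z : sqnorm z = 1 -> exists x, z = cexpi x.
Proof.
rewrite /sqnorm /cexpi; case: z => a b /= e.
have ha : -1 <= a <= 1.
  have := sqr_ge0 b; rewrite -(ler_norml a 1) -(expr_le1 (n:=2)) //.
  by rewrite real_normK ?num_real //; lra.
have sE : sin (acos a) = `|b|.
  by rewrite sin_acos // -(sqrtr_sqr b); congr Num.sqrt; lra.
have [b0|b0] := leP 0 b.
  by exists (acos a); rewrite acosK ?in_itv //= sE ger0_norm.
by exists (- acos a); rewrite cosN sinN acosK ?in_itv //= sE ltr0_norm ?opprK.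
Qed.

(** Up to a common sign, both sides are twice the oriented area of the triangle with sides z1, z2,
    z3. *)
Lemma Im_mulJ_rot {z1 z2 z3} : z1 + z2 + z3 = 0 ->
  Im (z1 * Num.conj z2) = Im (z2 * Num.conj z3).
Proof.
move=> /eqP; rewrite addr_eq0 => /eqP e.
have -> : z3 = - (z1 + z2) by rewrite e opprK.
rewrite !ReImE; ring.
Qed.

(** Heron's formula: each side is 16 times the squared area of the triangle. *)
Lemma heron {z1 z2 z3} (l1 l2 l3 : R) : z1 + z2 + z3 = 0 ->
  l1 ^+ 2 = sqnorm z1 -> l2 ^+ 2 = sqnorm z2 -> l3 ^+ 2 = sqnorm z3 ->
  4 * Im (z1 * Num.conj z2) ^+ 2 =
    (l1 + l2 + l3) * (l2 + l3 - l1) * (l1 + l3 - l2) * (l1 + l2 - l3).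
Proof.
move=> /eqP; rewrite addr_eq0 => /eqP e e1 e2 e3.
have {e} ez : z3 = - (z1 + z2) by rewrite e opprK.
(* By the law of cosines, the second squared term is twice the real part of z1 conj(z2). *)
transitivity (4 * l1 ^+ 2 * l2 ^+ 2 - (l3 ^+ 2 - l1 ^+ 2 - l2 ^+ 2) ^+ 2); last by ring.
rewrite e1 e2 e3 ez /sqnorm !ReImE; ring.
Qed.

(** Cauchy-Schwarz for the inner product [c] of z2 and z3 bounds [l1 ^+ 2] by [(l2 + l3) ^+ 2]. *)
Lemma triangle_side {z1 z2 z3} (l1 l2 l3 : R) : z1 + z2 + z3 = 0 ->
  0 <= l2 -> 0 <= l3 ->
  l1 ^+ 2 = sqnorm z1 -> l2 ^+ 2 = sqnorm z2 -> l3 ^+ 2 = sqnorm z3 ->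
  l1 <= l2 + l3.
Proof.
move=> e l20 l30 e1 e2 e3.
have ez : z1 = - (z2 + z3) by apply/eqP; rewrite -addr_eq0 addrA e.
pose c := Re z2 * Re z3 + Im z2 * Im z3.
have c_le : c <= l2 * l3.
  rewrite (le_trans (ler_norm _)) // -(@ler_pXn2r _ 2) ?nnegrE ?mulr_ge0 //.
  rewrite real_normK ?num_real // exprMn e2 e3 -subr_ge0.
  (* Lagrange's identity. *)
  have -> : sqnorm z2 * sqnorm z3 - c ^+ 2 = (Re z2 * Im z3 - Im z2 * Re z3) ^+ 2.
    by rewrite /sqnorm /c; ring.
  exact: sqr_ge0.
rewrite (le_trans (ler_norm _)) // -(@ler_pXn2r _ 2) ?nnegrE ?addr_ge0 //.
rewrite real_normK ?num_real // e1 ez sqrrD e2 e3 /sqnorm !ReImE -mulr_natl.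
rewrite /c in c_le; lra.
Qed.

Lemma amgm3 (u v w : R) : 0 <= u -> 0 <= v -> 0 <= w ->
  27 * (u * v * w) <= (u + v + w) ^+ 3.
Proof.
move=> u0 v0 w0.
(* The right side minus the left is three times this quantity plus half of the next one. *)
have : 0 <= u * (v - w) ^+ 2 + v * (u - w) ^+ 2 + w * (u - v) ^+ 2.
  by rewrite !addr_ge0 // mulr_ge0 ?sqr_ge0.
have : 0 <= (u + v + w) * ((u - v) ^+ 2 + (v - w) ^+ 2 + (u - w) ^+ 2).
  by rewrite mulr_ge0 ?addr_ge0 ?sqr_ge0.
nra.
Qed.

End ComplexTriangles.

(** * The Jarlskog invariant of a unitary 3 x 3 matrix *)

Lemma ord3_ind (P : 'I_3 -> Prop) : P 0 -> P 1 -> P 2 -> forall i, P i.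
Proof.
move=> P0 P1 P2 i; have : val i \in [:: 0; 1; 2]%N by case: i => [[|[|[|]]]].
rewrite !inE => /or3P[] /eqP e.
- by rewrite (_ : i = 0) //; exact: val_inj.
- by rewrite (_ : i = 1) //; exact: val_inj.
- by rewrite (_ : i = 2) //; exact: val_inj.
Qed.

Lemma ord3_succ0 : 0 + 1 = 1 :> 'I_3. Proof. exact: val_inj. Qed.
Lemma ord3_succ1 : 1 + 1 = 2 :> 'I_3. Proof. exact: val_inj. Qed.
Lemma ord3_succ2 : 2 + 1 = 0 :> 'I_3. Proof. exact: val_inj. Qed.
Definition ord3_succ := (ord3_succ0, ord3_succ1, ord3_succ2).

Lemma sum_ord3 (V : nmodType) (F : 'I_3 -> V) : \sum_k F k = F 0 + F 1 + F 2.
Proof.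
rewrite !big_ord_recl big_ord0 addr0 addrA.
by congr (F _ + F _ + F _); exact: val_inj.
Qed.

Lemma det_mx33 (T : comPzRingType) (M : 'M[T]_3) :
  \det M = M 0 0 * (M 1 1 * M 2 2 - M 1 2 * M 2 1)
         - M 0 1 * (M 1 0 * M 2 2 - M 1 2 * M 2 0)
         + M 0 2 * (M 1 0 * M 2 1 - M 1 1 * M 2 0).
Proof.
(* Reading the entries at natural numbers makes the indices built by the two cofactor expansions
   comparable by computation. *)
pose f (i j : nat) := M (inord i) (inord j).
have E i j : M i j = f i j by rewrite /f !inord_val.
rewrite (expand_det_row _ 0) sum_ord3 /cofactor.
rewrite !(expand_det_row _ ord0) !big_ord_recl !big_ord0 /cofactor !det_mx11 !mxE.
rewrite !E /= /bump /=.
rewrite !(expr0, expr1, expr2, addn0, add0n, exprS) /=; ring.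
Qed.

Section Jarlskog.
Context {R : realType}.
Implicit Types M p : 'M[R[i]]_3.

(* The paper's Im(p_22 conj(p_23) conj(p_32) p_33) is [jarl p 1]: indices start
   at 0 here. *)
Definition jarl p (k : 'I_3) : R :=
  Im ((p k 1 * Num.conj (p (k + 1) 1)) *
      Num.conj (p k 2 * Num.conj (p (k + 1) 2))).

Lemma rowJ p (i j : 'I_3) : p \is unitarymx ->
  p i 0 * Num.conj (p j 0) + p i 1 * Num.conj (p j 1) + p i 2 * Num.conj (p j 2)
    = (i == j)%:R.
Proof.
move=> /unitarymxP /matrixP /(_ i j); rewrite !mxE => <-.
by rewrite sum_ord3 !mxE.
Qed.

Lemma colJ p (i j : 'I_3) : p \is unitarymx ->
  p 0 i * Num.conj (p 0 j) + p 1 i * Num.conj (p 1 j) + p 2 i * Num.conj (p 2 j)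
    = (i == j)%:R.
Proof.
rewrite -trmx_unitary => /rowJ => /(_ i j); by rewrite !mxE.
Qed.

Lemma row_sqnorm p i : p \is unitarymx ->
  sqnorm (p i 0) + sqnorm (p i 1) + sqnorm (p i 2) = 1.
Proof. by move=> /(rowJ _ i i); rewrite eqxx !mulJ_sqnorm => -[]. Qed.

Lemma col_sqnorm p j : p \is unitarymx ->
  sqnorm (p 0 j) + sqnorm (p 1 j) + sqnorm (p 2 j) = 1.
Proof. by move=> /(colJ _ j j); rewrite eqxx !mulJ_sqnorm => -[]. Qed.

Lemma ord3_succ_neq (k : 'I_3) : k == k + 1 = false.
Proof. by elim/ord3_ind: k. Qed.

(** Regrouped by columns, [jarl p k] pairs two consecutive sides of the triangle with sides p_i1
    conj(p_i2), which closes because columns 1 and 2 are orthogonal. *)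
Lemma jarl_const p k l : p \is unitarymx -> jarl p k = jarl p l.
Proof.
move=> /(colJ _ 1 2) /= e.
have e01 := Im_mulJ_rot e.
have e12 : Im (p 1 1 * Num.conj (p 1 2) * Num.conj (p 2 1 * Num.conj (p 2 2))) =
           Im (p 2 1 * Num.conj (p 2 2) * Num.conj (p 0 1 * Num.conj (p 0 2))).
  by apply: Im_mulJ_rot; rewrite addrC addrA.
have E k' : jarl p k' = Im (p k' 1 * Num.conj (p k' 2) *
    Num.conj (p (k' + 1) 1 * Num.conj (p (k' + 1) 2))).
  by rewrite /jarl !ReImE; ring.
suff H k' : jarl p k' = jarl p 0 by rewrite !H.
rewrite !E; elim/ord3_ind: k' => [//||].
  by rewrite ord3_succ1 ord3_succ0 e01.
by rewrite ord3_succ2 ord3_succ0 e01 e12.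
Qed.

Definition row_prod p k j : R[i] := p k j * Num.conj (p (k + 1) j).

(** Orthogonality of rows k and k+1. The two sides that occur in [jarl] come first. *)
Lemma row_prod_sum p k : p \is unitarymx ->
  row_prod p k 1 + row_prod p k 2 + row_prod p k 0 = 0.
Proof. by move=> /(rowJ _ k (k + 1)); rewrite ord3_succ_neq -addrA addrC. Qed.

Lemma jarl_bound p k : p \is unitarymx -> 108 * jarl p k ^+ 2 <= 1.
Proof.
move=> up; pose l j := Num.sqrt (sqnorm (p k j)) * Num.sqrt (sqnorm (p (k + 1) j)).
have lE j : l j ^+ 2 = sqnorm (row_prod p k j).
  by rewrite /l exprMn !sqr_sqrtr ?sqnorm_ge0 // sqnormM sqnormJ.
have l0 j : 0 <= l j by rewrite mulr_ge0 ?sqrtr_ge0.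
have l_le j : 2 * l j <= sqnorm (p k j) + sqnorm (p (k + 1) j).
  have := sqr_ge0 (Num.sqrt (sqnorm (p k j)) - Num.sqrt (sqnorm (p (k + 1) j))).
  rewrite sqrrB !sqr_sqrtr ?sqnorm_ge0 // -/(l j) -mulr_natl; lra.
(* Both rows have norm 1, so adding the three inequalities 2ab <= a^2 + b^2 bounds the perimeter. *)
have s1 : l 1 + l 2 + l 0 <= 1.
  have := row_sqnorm _ k up; have := row_sqnorm _ (k + 1) up.
  have := l_le 0; have := l_le 1; have := l_le 2; lra.
have e120 := row_prod_sum _ k up.
have e201 : row_prod p k 2 + row_prod p k 0 + row_prod p k 1 = 0.
  by rewrite addrC addrA.
have e012 : row_prod p k 0 + row_prod p k 1 + row_prod p k 2 = 0.
  by rewrite addrC addrA.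
have t1 := triangle_side _ _ _ e120 (l0 2) (l0 0) (lE 1) (lE 2) (lE 0).
have t2 := triangle_side _ _ _ e201 (l0 0) (l0 1) (lE 2) (lE 0) (lE 1).
have t0 := triangle_side _ _ _ e012 (l0 1) (l0 2) (lE 0) (lE 1) (lE 2).
have := heron _ _ _ e120 (lE 1) (lE 2) (lE 0).
rewrite -/(jarl p k) => hJ.
(* The three factors of Heron's product other than the perimeter [s] add up to [s]; AM-GM for them,
   multiplied by [s], bounds 27 times the product by [s ^+ 4]. *)
have := amgm3 (l 2 + l 0 - l 1) (l 1 + l 0 - l 2) (l 1 + l 2 - l 0).
rewrite !subr_ge0 (addrC (l 1) (l 0)) => /(_ t1 t2 t0).
set s := l 1 + l 2 + l 0 in s1 hJ.
have -> : l 2 + l 0 - l 1 + (l 0 + l 1 - l 2) + (l 1 + l 2 - l 0) = s.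
  by rewrite /s; ring.
have s0 : 0 <= s by rewrite !addr_ge0.
move=> /(ler_wpM2l s0); rewrite -exprS => h.
have s4 : s ^+ 4 <= 1 by rewrite expr_le1.
have -> : 108 * jarl p k ^+ 2 = 27 * (4 * jarl p k ^+ 2) by ring.
rewrite hJ (le_trans _ s4) // (le_trans _ h) // le_eqVlt; apply/orP; left.
by apply/eqP; ring.
Qed.

(** A unitary matrix of this kind is a complex Hadamard matrix divided by sqrt 3. *)
Definition flat p := forall i j, sqnorm (p i j) = 3^-1.

(** The triangle is equilateral with side 1/3, so Heron's product is 1/27. *)
Lemma jarl_flat p k : p \is unitarymx -> flat p -> 108 * jarl p k ^+ 2 = 1.
Proof.
move=> up fp.
have lE j : 3^-1 ^+ 2 = sqnorm (row_prod p k j).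
  by rewrite sqnormM sqnormJ !fp.
have := heron _ _ _ (row_prod_sum _ k up) (lE 1) (lE 2) (lE 0).
rewrite -/(jarl p k) => h.
have -> : 108 * jarl p k ^+ 2 = 27 * (4 * jarl p k ^+ 2) by ring.
by rewrite h; field.
Qed.

(* Left multiplication by [rot k a b] replaces the rows r, r' of indices k, k+1
   by a r + b r' and conj(a) r' - conj(b) r. *)
Definition rot (k : 'I_3) (a b : R[i]) : 'M[R[i]]_3 := \matrix_(i, j)
  if i == k then a *+ (j == k) + b *+ (j == k + 1)
  else if i == k + 1 then Num.conj a *+ (j == k + 1) - Num.conj b *+ (j == k)
  else (i == j)%:R.

Lemma su3_pred_rot k a b : sqnorm a + sqnorm b = 1 -> su3_pred (rot k a b).
Proof.
move=> e.
have {}e : a * Num.conj a + b * Num.conj b = 1.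
  by rewrite !mulJ_sqnorm -rmorphD e.
have conjNJ (z : R[i]) : Num.conj (- Num.conj z) = - z.
  by apply: complex_ext; rewrite !ReImE ?opprK.
apply/andP; split; last first.
  rewrite det_mx33 !mxE; apply/eqP; transitivity (a * Num.conj a + b * Num.conj b) => //.
  by elim/ord3_ind: k; rewrite !ord3_succ /=
    ?(mulr0n, mulr1n, subr0, sub0r, addr0, add0r); ring.
apply/unitarymxP/matrixP => i j; rewrite !mxE sum_ord3 !mxE.
elim/ord3_ind: k; elim/ord3_ind: i; elim/ord3_ind: j;
  rewrite !ord3_succ /= ?(mulr0n, mulr1n, subr0, sub0r, addr0, add0r)
    ?(rmorph0, rmorph1, conjNJ, conjCK, mulr0, mul0r, mulr1, addr0, add0r) //;
  try by ring.
all: by rewrite -e; ring.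
Qed.
End Jarlskog.

(** * The multi-moment map *)

Section MultiMomentMap.
Context {R : realType}.
Implicit Types p : SU3 R.

Lemma unitary_SU3 p : su3_val p \is unitarymx.
Proof. by have /andP[] := valP p. Qed.

Lemma cos_sin_2pi3 :
  cos (2 * pi / 3) = - 2^-1 :> R /\ sin (2 * pi / 3) = Num.sqrt 3 / 2 :> R.
Proof.
(* sin x > 0 and cos 3x = 1, sin 3x = 0 determine cos x and sin x. *)
set x : R := 2 * pi / 3.
have pi0 : 0 < pi :> R := pi_gt0 R.
have s0 : 0 < sin x by rewrite sin_gt0_pi // /x; lra.
have cs := cos2Dsin2 x.
have x3 : x + x + x = pi *+ 2 by rewrite /x; field.
have c3 : cos (x + x + x) = 1 by rewrite x3 cos2pi.
have s3 : sin (x + x + x) = 0 by rewrite x3 sin2pi.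
move: c3 s3; rewrite !(cosD, sinD).
set c := cos x in cs *; set s := sin x in s0 cs * => c3 s3.
have h : s ^+ 2 = 3 * c ^+ 2.
  have : s * (3 * c ^+ 2 - s ^+ 2) = 0 by rewrite -[RHS]s3; ring.
  by move=> /eqP; rewrite mulf_eq0 gt_eqF //= subr_eq0 => /eqP.
have hc : c ^+ 2 = 4^-1 by lra.
have c2 : c = - 2^-1.
  have : c ^+ 2 * c - 3 * c * s ^+ 2 = 1 by rewrite -[RHS]c3; ring.
  rewrite h hc; lra.
split=> //; rewrite -(ger0_norm (ltW s0)) -sqrtr_sqr h hc.
have -> : 3 * 4^-1 = 3 * (2^-1) ^+ 2 :> R by field.
by rewrite sqrtrM // sqrtr_sqr ger0_norm // invr_ge0.
Qed.

Lemma cexpi_norm (x : R) : cexpi x * Num.conj (cexpi x) = 1.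
Proof.
by apply: complex_ext; rewrite !ReImE /=; [have <- := cos2Dsin2 x|]; ring.
Qed.

Lemma J0E (X : 'M[R[i]]_3) i j :
  J0 X i j = (2 / Num.sqrt 3)%:C * ((A0 R i i * Num.conj (A0 R j j) + 2^-1) * X i j).
Proof.
have uA : A0 R \is unitarymx.
  apply/unitarymxP; rewrite /A0 /diag3 tr_diag_mx map_diag_mx mulmx_diag.
  rewrite -diag_const_mx; congr diag_mx; apply/rowP => k; rewrite !mxE.
  elim/ord3_ind: k => /=; rewrite ?cexpi_norm //.
  by apply: complex_ext; rewrite !ReImE /=; ring.
have E : (A0 R *m X *m invmx (A0 R)) i j = A0 R i i * Num.conj (A0 R j j) * X i j.
  rewrite (invmx_unitary uA) /A0 /diag3 tr_diag_mx map_diag_mx mul_mx_diag mul_diag_mx.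
  rewrite !mxE !eqxx !mulr1n; ring.
rewrite /J0; move: (A0 R *m X *m _) E => M E.
by move: (_ * Num.conj _) E => c E; rewrite !mxE E (mulrDl c).
Qed.

(** Off the diagonal the scalar part [a] contributes nothing, as the columns of [p] are orthogonal.
    Both [basisU] and [basisV] have this form with a = -i, b = 3i. *)
Lemma proj_m_conj_diag p (a b : R[i]) (r : 'I_3) (d : 'rV[R[i]]_3) i j :
  (forall k, d 0 k = a + b *+ (k == r)) ->
  proj_m (invmx p *m diag_mx d *m p) i j =
    (b * (Num.conj (p r i) * p r j)) *+ (i != j).
Proof.
move=> dE; rewrite mxE; have [//|ij] := eqVneq i j; rewrite mulr1n.
rewrite (invmx_unitary (unitary_SU3 p)) mul_mx_diag mxE sum_ord3 !mxE !dE.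
have := colJ p j i (unitary_SU3 p); rewrite eq_sym (negbTE ij) mulr0n => e.
apply/eqP; rewrite -subr_eq0; apply/eqP.
transitivity (a * 0 : R[i]); last by rewrite mulr0.
rewrite -e; elim/ord3_ind: r {dE}; rewrite /=; ring.
Qed.

(** The diagonal of [A0] is w, conj(w), 1 for a primitive cube root of unity w. Cyclically
    consecutive entries have ratio conj(w), and 2/sqrt 3 (conj(w) + 1/2) = -i. *)
Lemma J0_succ (X : 'M[R[i]]_3) (i : 'I_3) :
  J0 X i (i + 1) = - 'i * X i (i + 1) /\ J0 X (i + 1) i = 'i * X (i + 1) i.
Proof.
have [c s] := cos_sin_2pi3.
have t2 : Num.sqrt 3 * Num.sqrt 3 = 3 :> R by rewrite -expr2 sqr_sqrtr.
have n3 : Num.sqrt 3 != 0 :> R by rewrite sqrtr_eq0 -ltNge.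
rewrite !J0E; move: (X i (i + 1)) (X (i + 1) i) => x y.
pose w : R[i] := (- 2^-1) +i* (Num.sqrt 3 / 2).
have w1 : A0 R 0 0 = w by rewrite /A0 /diag3 !mxE /= mulr1n /cexpi c s.
have ww : w * w = Num.conj w.
  apply: complex_ext; rewrite !ReImE /=; last by field.
  transitivity (4^-1 - Num.sqrt 3 * Num.sqrt 3 / 4 : R); first by field.
  by rewrite t2; field.
have w2 : A0 R 1 1 = Num.conj w.
  rewrite /A0 /diag3 !mxE /= mulr1n -ww.
  have -> : 4 * pi / 3 = 2 * pi / 3 + 2 * pi / 3 :> R by field.
  by rewrite cexpiD /cexpi c s.
have w3 : A0 R 2 2 = 1 by rewrite /A0 /diag3 !mxE /= mulr1n.
have e : A0 R i i * Num.conj (A0 R (i + 1) (i + 1)) = Num.conj w.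
  elim/ord3_ind: i; rewrite !ord3_succ ?w1 ?w2 ?w3 ?rmorph1 ?mulr1 ?mul1r //.
  by rewrite conjCK.
have e' : A0 R (i + 1) (i + 1) * Num.conj (A0 R i i) = w.
  by rewrite -[RHS]conjCK -e rmorphM /= conjCK mulrC.
rewrite e e'; split; rewrite mulrA; congr (_ * _);
  by apply: complex_ext; rewrite !ReImE /=; field.
Qed.

Lemma sigma0E (X Y : 'M[R[i]]_3) : (forall i, Y i i = 0) ->
  sigma0 X Y = 2^-1 * (Im (X 0 1 * Num.conj (Y 0 1)) + Im (X 1 2 * Num.conj (Y 1 2))
    + Im (X 2 0 * Num.conj (Y 2 0)) - Im (X 1 0 * Num.conj (Y 1 0))
    - Im (X 2 1 * Num.conj (Y 2 1)) - Im (X 0 2 * Num.conj (Y 0 2))).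
Proof.
move=> Y0.
have [X01 X10] := J0_succ X 0; have [X12 X21] := J0_succ X 1.
have [X20 X02] := J0_succ X 2; rewrite !ord3_succ in X01 X10 X12 X21 X20 X02.
rewrite /sigma0 /g0; move: (J0 X) X01 X10 X12 X21 X20 X02 => Z.
move=> X01 X10 X12 X21 X20 X02.
have E i j : (Z ^t* *m Y) i j = Num.conj (Z 0 i) * Y 0 j +
    Num.conj (Z 1 i) * Y 1 j + Num.conj (Z 2 i) * Y 2 j.
  by rewrite mxE sum_ord3 !mxE.
rewrite /mxtrace sum_ord3 !E !Y0 !mulr0 X01 X10 X12 X21 X20 X02.
have ReV2 (z : R[i]) : Re (2^-1 * z) = 2^-1 * Re z.
  have -> : 2^-1 = (2^-1)%:C :> R[i] by rewrite fmorphV rmorph_nat.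
  by rewrite Re_mul /= mul0r subr0.
have pos (x y : R[i]) : Re (Num.conj ('i * x) * y) = - Im (x * Num.conj y).
  by rewrite !ReImE /=; ring.
have neg (x y : R[i]) : Re (Num.conj (- 'i * x) * y) = Im (x * Num.conj y).
  by rewrite !ReImE /=; ring.
rewrite ReV2 !addr0 !add0r !Re_add !pos !neg; ring.
Qed.

(** Positions (i, j) and (j, i) contribute equally, which cancels the factor 1/2. The three
    resulting terms, each -9 times an oriented area, agree because the sides sum to zero. *)
Lemma sigma0_rows p (X Y : 'M[R[i]]_3) :
  (forall i j, X i j = 3 * 'i * (Num.conj (p 1 i) * p 1 j) *+ (i != j)) ->
  (forall i j, Y i j = 3 * 'i * (Num.conj (p 2 i) * p 2 j) *+ (i != j)) ->
  sigma0 X Y = - 27 * jarl p 1.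
Proof.
move=> XE YE; rewrite sigma0E => [|i]; last by rewrite YE eqxx.
have term (a b c d : R[i]) :
    Im (3 * 'i * (Num.conj a * b) * Num.conj (3 * 'i * (Num.conj c * d))) =
    - 9 * Im (a * Num.conj c * Num.conj (b * Num.conj d)).
  have -> : 3 = 3%:C :> R[i] by rewrite rmorph_nat.
  by rewrite !ReImE /=; ring.
rewrite !XE !YE /= !mulr1n !term.
have e := row_prod_sum p 1 (unitary_SU3 p); rewrite /jarl.
have e1 := Im_mulJ_rot e.
have e2 : Im (row_prod p 1 2 * Num.conj (row_prod p 1 0)) =
          Im (row_prod p 1 0 * Num.conj (row_prod p 1 1)).
  by apply: Im_mulJ_rot; rewrite addrC addrA.
have -> : - 27 * Im (row_prod p 1 1 * Num.conj (row_prod p 1 2)) =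
   - 9 * Im (row_prod p 1 1 * Num.conj (row_prod p 1 2))
   - 9 * Im (row_prod p 1 2 * Num.conj (row_prod p 1 0))
   - 9 * Im (row_prod p 1 0 * Num.conj (row_prod p 1 1)).
  by rewrite -e2 -e1; ring.
have anti (z w : R[i]) : Im (z * Num.conj w) = - Im (w * Num.conj z).
  by rewrite !ReImE; ring.
rewrite (anti (p 1 1 * _) (p 1 0 * _)) (anti (p 1 2 * _) (p 1 1 * _)).
by rewrite (anti (p 1 0 * _) (p 1 2 * _)) /row_prod ord3_succ; field.
Qed.

Lemma su3_nuE p : su3_nu p = - 27 * jarl p 1.
Proof.
apply: sigma0_rows => i j.
  rewrite /basisU (proj_m_conj_diag p (- 'i) (3 * 'i) 1) // => k.
  by rewrite !mxE; elim/ord3_ind: k => /=; rewrite ?mulr0n ?mulr1n; ring.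
rewrite /basisV (proj_m_conj_diag p (- 'i) (3 * 'i) 2) // => k.
by rewrite !mxE; elim/ord3_ind: k => /=; rewrite ?mulr0n ?mulr1n; ring.
Qed.

End MultiMomentMap.

(** * Critical points *)

Section CriticalPoints.
Context {R : realType}.
Implicit Types p q : SU3 R.

Lemma rot_row k (a b : R[i]) (M : 'M[R[i]]_3) j :
  (rot k a b *m M) k j = a * M k j + b * M (k + 1) j.
Proof.
rewrite mxE sum_ord3 !mxE.
by elim/ord3_ind: k; rewrite !ord3_succ /= ?(mulr0n, mulr1n) !(addr0, add0r); ring.
Qed.

Lemma rot_row_succ k (a b : R[i]) (M : 'M[R[i]]_3) j :
  (rot k a b *m M) (k + 1) j = Num.conj a * M (k + 1) j - Num.conj b * M k j.
Proof.
rewrite mxE sum_ord3 !mxE.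
by elim/ord3_ind: k; rewrite !ord3_succ /= ?(mulr0n, mulr1n) !(addr0, add0r); ring.
Qed.

Definition row_gap (M : 'M[R[i]]_3) k j : R :=
  sqnorm (M (k + 1) j) - sqnorm (M k j).

(** Such a rotation fixes the imaginary part of each [row_prod] and moves only the real part. The
    formula is exact in [x], so it can be differentiated directly. *)
Lemma jarl_rot_real k (x : R) (M : 'M[R[i]]_3) :
  jarl (rot k (cos x)%:C (sin x)%:C *m M) k =
    (cos x * cos x - sin x * sin x) * jarl M k
    + cos x * sin x * (row_gap M k 2 * Im (row_prod M k 1)
                       - row_gap M k 1 * Im (row_prod M k 2)).
Proof.
have E j : row_prod (rot k (cos x)%:C (sin x)%:C *m M) k j =
    ((cos x * cos x - sin x * sin x) * Re (row_prod M k j)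
      + cos x * sin x * row_gap M k j) +i* Im (row_prod M k j).
  rewrite /row_prod rot_row rot_row_succ /row_gap /sqnorm.
  move: (M k j) (M (k + 1) j) (cos2Dsin2 x) => [x1 y1] [x2 y2] cs.
  apply: complex_ext; rewrite !ReImE /=; first by ring.
  by rewrite -[RHS]mul1r -cs; ring.
rewrite [LHS]/jarl -!/(row_prod _ _ _) !E !ReImE /=.
by rewrite /jarl -!/(row_prod _ _ _) !ReImE; ring.
Qed.

(** Here the real parts stay fixed and the imaginary parts move. *)
Lemma jarl_rot_imag k (x : R) (M : 'M[R[i]]_3) :
  jarl (rot k (cos x)%:C ((sin x) *i) *m M) k =
    (cos x * cos x - sin x * sin x) * jarl M k
    + cos x * sin x * (row_gap M k 1 * Re (row_prod M k 2)
                       - row_gap M k 2 * Re (row_prod M k 1)).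
Proof.
have E j : row_prod (rot k (cos x)%:C ((sin x) *i) *m M) k j =
    Re (row_prod M k j) +i* ((cos x * cos x - sin x * sin x) * Im (row_prod M k j)
      + cos x * sin x * row_gap M k j).
  rewrite /row_prod rot_row rot_row_succ /row_gap /sqnorm.
  move: (M k j) (M (k + 1) j) (cos2Dsin2 x) => [x1 y1] [x2 y2] cs.
  apply: complex_ext; rewrite !ReImE /=; last by ring.
  by rewrite -[RHS]mul1r -cs; ring.
rewrite [LHS]/jarl -!/(row_prod _ _ _) !E !ReImE /=.
by rewrite /jarl -!/(row_prod _ _ _) !ReImE; ring.
Qed.

(** The form in which [critical] asks for differentiability of the entries of a curve. *)
Definition cderivable (f : R -> R[i]) := derivable (fun s => Re (f s)) 0 1 /\
  derivable (fun s => Im (f s)) 0 1.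

Lemma cderivable_cst z : cderivable (fun=> z).
Proof. by split; exact: derivable_cst. Qed.

Lemma cderivableD f g : cderivable f -> cderivable g ->
  cderivable (fun s => f s + g s).
Proof.
move=> [rf jf] [rg jg]; split.
  by under eq_fun do rewrite Re_add; exact: (derivableD rf rg).
by under eq_fun do rewrite Im_add; exact: (derivableD jf jg).
Qed.

Lemma cderivableN f : cderivable f -> cderivable (fun s => - f s).
Proof.
move=> [rf jf]; split.
  by under eq_fun do rewrite Re_opp; exact: (derivableN rf).
by under eq_fun do rewrite Im_opp; exact: (derivableN jf).
Qed.

Lemma cderivable_conj f : cderivable f -> cderivable (fun s => Num.conj (f s)).
Proof.
move=> [rf jf]; split.
  by under eq_fun do rewrite Re_conj; exact: rf.
by under eq_fun do rewrite Im_conj; exact: (derivableN jf).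
Qed.

Lemma cderivableM f g : cderivable f -> cderivable g ->
  cderivable (fun s => f s * g s).
Proof.
move=> [rf jf] [rg jg]; split.
  under eq_fun do rewrite Re_mul.
  exact: (derivableB (derivableM rf rg) (derivableM jf jg)).
under eq_fun do rewrite Im_mul.
exact: (derivableD (derivableM rf jg) (derivableM jf rg)).
Qed.

Definition SU3_rot k (a b : R[i]) (ab : sqnorm a + sqnorm b = 1) : SU3 R :=
  MkSU3 (su3_pred_rot k a b ab).

Lemma cderivable_rot k (a b : R -> R[i]) i j : cderivable a -> cderivable b ->
  cderivable (fun s => rot k (a s) (b s) i j).
Proof.
move=> da db; under eq_fun do rewrite mxE.
have dMn f (n : bool) : cderivable f -> cderivable (fun s => f s *+ n).
  by case: n => df; [exact: df | exact: (cderivable_cst 0)].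
case: (i == k).
  exact: (cderivableD _ _ (dMn _ _ da) (dMn _ _ db)).
case: (i == k + 1); last exact: (cderivable_cst _).
apply: (cderivableD _ _ (dMn _ _ (cderivable_conj _ da))).
exact: (cderivableN _ (dMn _ _ (cderivable_conj _ db))).
Qed.

Lemma cderivable_mulmx_cst (f : R -> 'M[R[i]]_3) (M : 'M[R[i]]_3) :
  (forall i j, cderivable (fun s => f s i j)) ->
  forall i j, cderivable (fun s => (f s *m M) i j).
Proof.
move=> df i j; under eq_fun do rewrite mxE sum_ord3.
have dM k : cderivable (fun s => f s i k * M k j).
  exact: (cderivableM _ _ (df i k) (cderivable_cst _)).
exact: (cderivableD _ _ (cderivableD _ _ (dM 0) (dM 1)) (dM 2)).
Qed.

Lemma flag_nuE p k : flag_nu (\pi_(flag R) p) = - 27 * jarl p k.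
Proof. by rewrite flag_nu_pi su3_nuE (jarl_const p k 1 (unitary_SU3 p)). Qed.

(** The rotations move [p] along a curve in SU(3) on which the derivative of nu at 0 is -27 K. *)
Lemma critical_rot p k (a b : R -> R[i]) (K : R) :
  critical (\pi_(flag R) p) ->
  (forall s, sqnorm (a s) + sqnorm (b s) = 1) -> a 0 = 1 -> b 0 = 0 ->
  cderivable a -> cderivable b ->
  (forall s, jarl (rot k (a s) (b s) *m p) k =
    (cos s * cos s - sin s * sin s) * jarl p k + cos s * sin s * K) ->
  K = 0.
Proof.
move=> cp ab a0 b0 da db jE.
pose gamma s : SU3 R := (SU3_rot k (a s) (b s) (ab s) * p)%g.
have gE s : gamma s = rot k (a s) (b s) *m p :> 'M[R[i]]_3 by [].
have g0 : gamma 0 = p.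
  apply: val_inj; apply: (etrans (gE 0)); rewrite a0 b0.
  rewrite -[RHS]mul1mx; congr (_ *m _); apply/matrixP => i j; rewrite !mxE.
  elim/ord3_ind: k {jE gamma gE}; elim/ord3_ind: i; elim/ord3_ind: j;
    rewrite !ord3_succ /= ?(mulr0n, mulr1n) ?rmorph0 ?rmorph1 ?addr0 ?subr0 //.
have dg : is_derive (0 : R) 1 (fun s => flag_nu (\pi_(flag R) (gamma s))) 0.
  apply: cp; last by rewrite g0.
  by move=> i j; apply: (cderivable_mulmx_cst (fun s => rot k (a s) (b s)));
    move=> ? ?; exact: cderivable_rot.
have dc := is_derive_cos (0 : R); have ds := is_derive_sin (0 : R).
pose f : R -> R :=
  (-27) \*: (jarl p k \*: (cos * cos - sin * sin) + K \*: (cos * sin)).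
have fE : (fun s => flag_nu (\pi_(flag R) (gamma s))) = f.
  apply/funext => s; rewrite (flag_nuE _ k) gE jE.
  have -> : f s = -27 * (jarl p k * (cos s * cos s - sin s * sin s)
    + K * (cos s * sin s)) by [].
  ring.
have dccss := is_deriveB (is_deriveM dc dc) (is_deriveM ds ds).
have df : is_derive (0 : R) 1 f _ := is_deriveZ (-27 : R)
  (is_deriveD (is_deriveZ (jarl p k) dccss) (is_deriveZ K (is_deriveM dc ds))).
have := @derive_val _ _ _ _ _ _ _ df.
rewrite -fE (@derive_val _ _ _ _ _ _ _ dg) cos0 sin0 /GRing.scale /=.
lra.
Qed.

(** Difference quotients are nonpositive to the right of [c] and nonnegative to the left. *)
Lemma is_derive_max (f : R -> R) c : derivable f c 1 ->
  (forall t, f t <= f c) -> is_derive c 1 f 0.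
Proof.
move=> df fmax; apply: DeriveDef => //.
have q : h^-1 *: (f (h *: 1 + c) - f c) @[h --> 0^'] --> 'D_1 f c := df.
apply/eqP; rewrite eq_le; apply/andP; split.
  apply: (cvgr_to_le (cvg_dnbhs_at_right q)); near=> h.
  by apply: mulr_ge0_le0; rewrite ?subr_le0 // invr_ge0 ltW.
apply: (cvgr_to_ge (cvg_dnbhs_at_left q)); near=> h.
by apply: mulr_le0; rewrite ?subr_le0 // invr_le0 ltW.
Unshelve. all: by end_near. Qed.

Lemma is_derive_min (f : R -> R) c : derivable f c 1 ->
  (forall t, f c <= f t) -> is_derive c 1 f 0.
Proof.
move=> df fmin; have fmax t : (- f) t <= (- f) c by rewrite lerN2.
by have := is_deriveN (is_derive_max _ _ (derivableN df) fmax); rewrite opprK oppr0.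
Qed.

Lemma critical_flat p : critical (\pi_(flag R) p) ->
  flag_nu (\pi_(flag R) p) <> 0 -> flat p.
Proof.
move=> cp np.
have dcos : cderivable (fun s : R => (cos s)%:C).
  by split; [exact: ex_derive | exact: derivable_cst].
have dsin : cderivable (fun s : R => (sin s)%:C).
  by split; [exact: ex_derive | exact: derivable_cst].
have dsini : cderivable (fun s : R => (sin s) *i).
  by split; [exact: derivable_cst | exact: ex_derive].
have step k j : sqnorm (p (k + 1) j) = sqnorm (p k j).
  have Kr : row_gap p k 2 * Im (row_prod p k 1)
               - row_gap p k 1 * Im (row_prod p k 2) = 0.
    apply: (critical_rot p k (fun s => (cos s)%:C) (fun s => (sin s)%:C)) => //.
    - by move=> s; rewrite /sqnorm /= expr0n /= !addr0 cos2Dsin2.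
    - by rewrite cos0.
    - by rewrite sin0.
    - by move=> s; exact: jarl_rot_real.
  have Ki : row_gap p k 1 * Re (row_prod p k 2)
               - row_gap p k 2 * Re (row_prod p k 1) = 0.
    apply: (critical_rot p k (fun s => (cos s)%:C) (fun s => (sin s) *i)) => //.
    - by move=> s; rewrite /sqnorm /= expr0n /= addr0 add0r cos2Dsin2.
    - by rewrite cos0.
    - by rewrite sin0.
    - by move=> s; exact: jarl_rot_imag.
  have Jk : jarl p k != 0.
    by apply/eqP => J; apply: np; rewrite (flag_nuE _ k) J mulr0.
  have JE : jarl p k = Im (row_prod p k 1) * Re (row_prod p k 2)
              - Re (row_prod p k 1) * Im (row_prod p k 2).
    by rewrite /jarl -!/(row_prod _ _ _) !ReImE; ring.
  (* Cramer's rule: this combination of [Kr] and [Ki] eliminates the gap of column 2 and leaves the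
     gap of column 1 times [jarl p k]. *)
  have g1 : row_gap p k 1 = 0.
    apply: (mulIf Jk); rewrite mul0r JE.
    transitivity (Im (row_prod p k 1) * (row_gap p k 1 * Re (row_prod p k 2) -
        row_gap p k 2 * Re (row_prod p k 1)) +
      Re (row_prod p k 1) * (row_gap p k 2 * Im (row_prod p k 1)
        - row_gap p k 1 * Im (row_prod p k 2))); first by ring.
    by rewrite Kr Ki !mulr0 addr0.
  have g2 : row_gap p k 2 = 0.
    apply: (mulIf Jk); rewrite mul0r JE.
    transitivity (Im (row_prod p k 2) * (row_gap p k 1 * Re (row_prod p k 2) -
        row_gap p k 2 * Re (row_prod p k 1)) +
      Re (row_prod p k 2) * (row_gap p k 2 * Im (row_prod p k 1)
        - row_gap p k 1 * Im (row_prod p k 2))); first by ring.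
    by rewrite Kr Ki !mulr0 addr0.
  (* The gap of column 0 vanishes too, since both rows have norm 1. *)
  have := row_sqnorm p k (unitary_SU3 p).
  have := row_sqnorm p (k + 1) (unitary_SU3 p).
  move: g1 g2; rewrite /row_gap.
  elim/ord3_ind: j; lra.
(* Each column now has three equal squared moduli with sum 1. *)
move=> i j; have := col_sqnorm p j (unitary_SU3 p).
have := step 0 j; have := step 1 j; rewrite !ord3_succ.
elim/ord3_ind: i; lra.
Qed.

(** Along a differentiable curve nu is a polynomial in the real and imaginary parts of the entries,
    hence differentiable, and its derivative vanishes at a global extremum. *)
Lemma extremum_critical (x : flag R) :
  (forall y, flag_nu y <= flag_nu x) \/ (forall y, flag_nu x <= flag_nu y) ->
  critical x.
Proof.
move=> ext gamma dg gx.
have df : derivable (fun s : R => flag_nu (\pi_(flag R) (gamma s))) 0 1.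
  under eq_fun do rewrite (flag_nuE _ 0).
  have cg i j : cderivable (fun s => gamma s i j) by exact: dg.
  have cz j : cderivable (fun s => row_prod (gamma s) 0 j).
    exact: (cderivableM _ _ (cg _ _) (cderivable_conj _ (cg _ _))).
  have [_ cJ] := cderivableM _ _ (cz 1) (cderivable_conj _ (cz 2)).
  exact: (@derivableZ _ _ _ _ (-27) _ _ cJ).
rewrite -gx in ext; case: ext => ext.
  exact: (is_derive_max _ _ df (fun t => ext _)).
exact: (is_derive_min _ _ df (fun t => ext _)).
Qed.
End CriticalPoints.

(** * Torus orbits *)

Section TorusOrbits.
Context {R : realType}.
Implicit Types p q : SU3 R.

(** Twice the real part is |z3|^2 - |z1|^2 - |z2|^2 = -1/9. *)
Lemma equilateral_mulJ {z1 z2 z3 : R[i]} : z1 + z2 + z3 = 0 ->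
  sqnorm z1 = 9^-1 -> sqnorm z2 = 9^-1 -> sqnorm z3 = 9^-1 ->
  z1 * Num.conj z2 = (- 18^-1) +i* Im (z1 * Num.conj z2).
Proof.
move=> /eqP; rewrite addr_eq0 => /eqP e n1 n2.
have {e} -> : z3 = - (z1 + z2) by rewrite e opprK.
move: n1 n2; rewrite /sqnorm => n1 n2 n3; apply: complex_ext => //=.
by move: n1 n2 n3; rewrite !ReImE; lra.
Qed.

(** Equilateral triangles fix the moduli and real parts of these products, and [jarl] fixes the
    imaginary parts. *)
Lemma flat_row_prod_conj p q k j : flat p -> flat q -> jarl p k = jarl q k ->
  row_prod p k j * Num.conj (row_prod p k 1) =
  row_prod q k j * Num.conj (row_prod q k 1).
Proof.
move=> fp fq Jpq.
have n (r : SU3 R) i : flat r -> sqnorm (row_prod r k i) = 9^-1.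
  by move=> fr; rewrite sqnormM sqnormJ !fr; field.
have E (r : SU3 R) i : flat r ->
    row_prod r k i * Num.conj (row_prod r k 1) =
    if i == 1 then (9^-1)%:C else if i == 0 then (- 18^-1) +i* jarl r k
    else (- 18^-1) -i* jarl r k.
  move=> fr.
  have e120 := row_prod_sum r k (unitary_SU3 r).
  have e201 : row_prod r k 2 + row_prod r k 0 + row_prod r k 1 = 0.
    by rewrite addrC addrA.
  have e012 : row_prod r k 0 + row_prod r k 1 + row_prod r k 2 = 0.
    by rewrite addrC addrA.
  elim/ord3_ind: i => /=.
  - rewrite (equilateral_mulJ e012) ?n //; congr (_ +i* _).
    exact: (Im_mulJ_rot e012).
  - by rewrite mulJ_sqnorm n.
  - rewrite -[LHS]conjCK rmorphM /= conjCK mulrC.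
    by rewrite (equilateral_mulJ e120) ?n.
by rewrite !E // Jpq.
Qed.

(** The entrywise quotient [m] of [q] by [p] has unimodular entries, and the ratio [r] of its
    consecutive rows is the same in every column. So [m] has rank one and splits into row and column
    phases. *)
Lemma flat_scaling p q : flat p -> flat q -> jarl p 0 = jarl q 0 ->
  exists mu nu : 'I_3 -> R[i],
    [/\ forall k, sqnorm (mu k) = 1, forall j, sqnorm (nu j) = 1
      & forall k j, q k j = mu k * p k j * nu j].
Proof.
move=> fp fq Jpq.
have p0 k j : p k j != 0.
  by apply/eqP => p0; have := fp k j; rewrite p0 /sqnorm /= expr0n /= addr0; lra.
pose m k j := q k j / p k j.
have qE k j : q k j = m k j * p k j by rewrite /m divfK.
have m1 k j : sqnorm (m k j) = 1.
  have := fq k j; rewrite qE sqnormM fp; lra.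
have mJ k j : m k j * Num.conj (m k j) = 1 by rewrite mulJ_sqnorm m1.
pose r k j := m k j * Num.conj (m (k + 1) j).
have rE k j : row_prod q k j = r k j * row_prod p k j.
  by rewrite /row_prod !qE rmorphM /r /=; ring.
have r1 k j : sqnorm (r k j) = 1 by rewrite sqnormM sqnormJ !m1 mulr1.
have r_const k j : r k j = r k 1.
  have J : jarl p k = jarl q k.
    rewrite (jarl_const p k 0 (unitary_SU3 p)).
    by rewrite (jarl_const q k 0 (unitary_SU3 q)).
  have := flat_row_prod_conj p q k j fp fq J; rewrite !rE => h.
  have {}h : r k j * Num.conj (r k 1) = 1.
    apply: (mulIf (_ : row_prod p k j * Num.conj (row_prod p k 1) != 0)).
      by rewrite !mulf_neq0 // conjC_eq0 // mulf_neq0 // conjC_eq0.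
    by rewrite mul1r; apply: etrans (esym h); rewrite (rmorphM _ (r k 1)) /=; ring.
  have r11 : Num.conj (r k 1) * r k 1 = 1 by rewrite mulrC mulJ_sqnorm r1.
  by rewrite -[LHS]mulr1 -r11 mulrA h mul1r.
exists (fun k => m k 1 * Num.conj (m 2 1)), (fun j => m 2 j); split=> //.
  by move=> k; rewrite sqnormM sqnormJ !m1 mulr1.
move=> k j; rewrite [LHS]qE.
suff -> : m k j = m k 1 * Num.conj (m 2 1) * m 2 j by ring.
suff h : m k j * Num.conj (m 2 j) = m k 1 * Num.conj (m 2 1).
  by rewrite -h -mulrA [X in _ * X]mulrC mJ mulr1.
have swap (a b : R[i]) : a * Num.conj b = Num.conj (b * Num.conj a).
  by rewrite rmorphM /= conjCK mulrC.
have r2 := r_const 1 j; have r3 := r_const 2 j.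
rewrite /r !ord3_succ in r2 r3; elim/ord3_ind: k => //.
  by rewrite swap r3 -swap.
by rewrite !mJ.
Qed.

Lemma det_diag3 (a b c : R[i]) : \det (diag3 a b c) = a * b * c.
Proof. by rewrite /diag3 det_diag !big_ord_recl big_ord0 !mxE /= mulr1 mulrA. Qed.

Lemma su3_pred_torus (x y : R) :
  su3_pred (diag3 (cexpi x) (cexpi y) (cexpi (- (x + y)))).
Proof.
apply/andP; split; last first.
  by rewrite det_diag3 -!cexpiD subrr /cexpi cos0 sin0.
apply/unitarymxP; rewrite /diag3 tr_diag_mx map_diag_mx mulmx_diag.
rewrite -diag_const_mx; congr diag_mx; apply/rowP => k; rewrite !mxE.
by elim/ord3_ind: k => /=; rewrite cexpi_norm.
Qed.

Lemma diag3_mul (a b c : R[i]) (M : 'M[R[i]]_3) i j :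
  (diag3 a b c *m M) i j = [:: a; b; c]`_i * M i j.
Proof. by rewrite /diag3 mul_diag_mx !mxE. Qed.

Lemma mul_diag3 (a b c : R[i]) (M : 'M[R[i]]_3) i j :
  (M *m diag3 a b c) i j = M i j * [:: a; b; c]`_j.
Proof. by rewrite /diag3 mul_mx_diag !mxE. Qed.

Lemma scaling_torus p q (mu nu : 'I_3 -> R[i]) :
  (forall k, sqnorm (mu k) = 1) -> (forall j, sqnorm (nu j) = 1) ->
  (forall k j, q k j = mu k * p k j * nu j) ->
  exists s t, [/\ torus s, torus t & q = (s * p * t)%g].
Proof.
move=> mu1 nu1 qE.
have [x0 x0E] := cexpi_surj _ (mu1 0); have [y0 y0E] := cexpi_surj _ (nu1 0).
have [x1 x1E] := cexpi_surj _ (mu1 1); have [y1 y1E] := cexpi_surj _ (nu1 1).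
have [x2 x2E] := cexpi_surj _ (mu1 2); have [y2 y2E] := cexpi_surj _ (nu1 2).
have muE k : mu k = [:: cexpi x0; cexpi x1; cexpi x2]`_k by elim/ord3_ind: k.
have nuE k : nu k = [:: cexpi y0; cexpi y1; cexpi y2]`_k by elim/ord3_ind: k.
have det1 (r : SU3 R) : \det (su3_val r) = 1 by have /andP[_ /eqP] := valP r.
(* Comparing determinants: [p] and [q] both have determinant 1, so the six phases multiply to 1. *)
have total : cexpi (x0 + x1 + x2 + (y0 + y1 + y2)) = 1 :> R[i].
  have qD : su3_val q = diag3 (cexpi x0) (cexpi x1) (cexpi x2) *m p
      *m diag3 (cexpi y0) (cexpi y1) (cexpi y2).
    by apply/matrixP => k j; rewrite mul_diag3 diag3_mul -muE -nuE.
  have := det1 q; rewrite qD !det_mulmx !det_diag3 det1 mulr1 => <-.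
  by rewrite !cexpiD.
(* Moving the scalar cexpi d from the left factor to the right one makes both
   determinants 1. *)
pose d := (x0 + x1 + x2) / 3.
exists (MkSU3 (su3_pred_torus (x0 - d) (x1 - d))).
exists (MkSU3 (su3_pred_torus (y0 + d) (y1 + d))).
split; [by exists (x0 - d), (x1 - d) | by exists (y0 + d), (y1 + d) |].
apply: val_inj; apply/matrixP => k j.
rewrite [RHS]mul_diag3 diag3_mul /= [LHS]qE.
have -> : - (x0 - d + (x1 - d)) = x2 - d by rewrite /d; field.
have -> : cexpi (- (y0 + d + (y1 + d))) = cexpi (y2 + d) :> R[i].
  by rewrite -[LHS]mulr1 -total -cexpiD; congr cexpi; rewrite /d; field.
have sE : [:: cexpi (x0 - d); cexpi (x1 - d); cexpi (x2 - d)]`_k = mu k * cexpi (- d).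
  by rewrite muE; elim/ord3_ind: k; rewrite /= cexpiD.
have tE : [:: cexpi (y0 + d); cexpi (y1 + d); cexpi (y2 + d)]`_j = nu j * cexpi d.
  by rewrite nuE; elim/ord3_ind: j; rewrite /= cexpiD.
have dd : cexpi (- d) * cexpi d = 1 :> R[i].
  by rewrite -cexpiD addrC subrr /cexpi cos0 sin0.
rewrite sE tE -[LHS]mulr1 -dd; ring.
Qed.

(** All [row_prod] of rows 1 and 2 get the same unimodular factor, which cancels in [jarl]. *)
Lemma flag_nu_act (t : SU3 R) (x : flag R) : torus t ->
  flag_nu (flag_act t x) = flag_nu x.
Proof.
move=> [a [b tE]]; rewrite -[x]reprK flag_act_pi !(flag_nuE _ 1).
congr (_ * _); move: (repr x) => p.
pose c := [:: cexpi a; cexpi b; cexpi (- (a + b))].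
have E j : row_prod (t * p)%g 1 j = (c`_1 * Num.conj c`_2) * row_prod p 1 j.
  have tp k : (t * p)%g k j = c`_k * p k j by rewrite -diag3_mul -tE.
  by rewrite /row_prod !tp ord3_succ rmorphM /=; ring.
have scale (u z w : R[i]) :
    Im (u * z * Num.conj (u * w)) = sqnorm u * Im (z * Num.conj w).
  by rewrite /sqnorm !ReImE; ring.
have cexpi1 (z : R) : sqnorm (cexpi z) = 1 by rewrite /sqnorm /= cos2Dsin2.
by rewrite [LHS]/jarl -!/(row_prod _ _ _) !E scale sqnormM sqnormJ !cexpi1 !mul1r //.
Qed.

(** This is 3 sqrt 3 / 2; its square is 27^2 / 108. *)
Definition nu_max : R := Num.sqrt (27 / 4).

Lemma nu_max_gt0 : 0 < nu_max.
Proof. by rewrite sqrtr_gt0; lra. Qed.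

Lemma nu_max_neqN : nu_max <> - nu_max.
Proof. by have := nu_max_gt0; lra. Qed.

Lemma nu_max_sqr : nu_max ^+ 2 = 27 / 4.
Proof. by rewrite sqr_sqrtr //; lra. Qed.

Lemma flag_nu_bound (x : flag R) : - nu_max <= flag_nu x <= nu_max.
Proof.
have m0 := ltW nu_max_gt0.
rewrite -[x]reprK (flag_nuE _ 0) -ler_norml -(@ler_pXn2r _ 2) ?nnegrE //.
rewrite real_normK ?num_real // nu_max_sqr.
by have := jarl_bound _ 0 (unitary_SU3 (repr x)); lra.
Qed.

Lemma flat_flag_nu p : flat p ->
  flag_nu (\pi_(flag R) p) = nu_max \/ flag_nu (\pi_(flag R) p) = - nu_max.
Proof.
move=> fp; have J := jarl_flat _ 0 (unitary_SU3 p) fp.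
have /eqP : flag_nu (\pi_(flag R) p) ^+ 2 = nu_max ^+ 2.
  by rewrite (flag_nuE _ 0) nu_max_sqr; lra.
by rewrite eqf_sqr => /orP[] /eqP; [left | right].
Qed.

(** A critical point with nu nonzero is flat, so nu attains its bound there; conversely, a point
    attaining the bound is a global extremum. *)
Lemma critical_extremal (x : flag R) : (critical x /\ flag_nu x <> 0) <->
  flag_nu x = nu_max \/ flag_nu x = - nu_max.
Proof.
have m0 := nu_max_gt0; split.
  by rewrite -[x]reprK => -[cx nx]; apply/flat_flag_nu/critical_flat.
move=> ex; split; last by case: ex => ->; lra.
apply: extremum_critical; case: ex => ->; [left | right] => y;
  by case/andP: (flag_nu_bound y).
Qed.

(** The equality case of the bound is settled through criticality, not by tracing equality in
    AM-GM. *)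
Lemma extremal_flat p m : m = nu_max \/ m = - nu_max ->
  flag_nu (\pi_(flag R) p) = m -> flat p.
Proof.
move=> mE e.
have [cp np] : critical (\pi_(flag R) p) /\ flag_nu (\pi_(flag R) p) <> 0.
  by apply: (proj2 (critical_extremal _)); case: mE => mE; [left | right];
    exact: (etrans e mE).
exact: critical_flat cp np.
Qed.

Lemma torus_orbitE (x : flag R) m : m = nu_max \/ m = - nu_max ->
  flag_nu x = m -> torus_orbit x = [set y | flag_nu y = m].
Proof.
move=> mE xm; apply/seteqP; split => [_ [t tt <-]|y] /=.
  exact: (etrans (flag_nu_act _ _ tt) xm).
move: xm; rewrite -[x]reprK -[y]reprK; move: (repr x) (repr y) => p q pm qm.
have n27 : - 27 != 0 :> R by rewrite oppr_eq0 pnatr_eq0.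
have J := mulfI n27 (etrans (esym (flag_nuE p 0))
  (etrans pm (etrans (esym qm) (flag_nuE q 0)))).
have [mu [nu [mu1 nu1 E]]] :=
  flat_scaling _ _ (extremal_flat _ _ mE pm) (extremal_flat _ _ mE qm) J.
have [s [t [ts tt ->]]] := scaling_torus _ _ _ _ mu1 nu1 E.
(* The right factor [t] disappears in the quotient. *)
exists s => //; rewrite flag_act_pi; apply/eqmodP/asboolP.
by rewrite mulKg.
Qed.

Lemma exists_flat : exists p, flat p.
Proof.
(* The discrete Fourier matrix, rescaled to determinant 1. *)
pose w : R[i] := (- 2^-1) +i* (Num.sqrt 3 / 2); pose v := Num.conj w.
(* Modulus 1/sqrt 3 makes the matrix unitary; the argument is chosen so that c^3 times the unscaled
   determinant 3(v - w) = -3i sqrt 3 is 1. *)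
pose c : R[i] := 0 -i* (Num.sqrt 3 / 3).
have t2 : Num.sqrt 3 ^+ 2 = 3 :> R by rewrite sqr_sqrtr.
have sw : sqnorm w = 1 by rewrite /sqnorm /= expr_div_n t2; lra.
have sc : sqnorm c = 3^-1 by rewrite /sqnorm /= sqrrN expr_div_n t2; lra.
have wv : w * v = 1 by rewrite mulJ_sqnorm sw.
have vE : v = - 1 - w by apply: complex_ext; rewrite !ReImE /=; lra.
have ww : w * w = v.
  transitivity (- w - w * v); first by rewrite vE; ring.
  by rewrite wv vE; ring.
have vv : v * v = w.
  transitivity (- v - w * v); first by rewrite vE; ring.
  by rewrite wv vE; ring.
have cc : c * Num.conj c = (3^-1)%:C by rewrite mulJ_sqnorm sc.
have h3 : (3^-1)%:C * 3 = 1 :> R[i].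
  by rewrite fmorphV rmorph_nat mulVf // pnatr_eq0.
have c3 : c * c * c * (3 * (v - w)) = 1.
  have cw : c * (v - w) = - 1.
    apply: complex_ext; rewrite !ReImE /=; last by ring.
    transitivity (- (Num.sqrt 3 ^+ 2 / 3) : R); first by field.
    by rewrite t2; field.
  have c2 : c * c = - (3^-1)%:C.
    apply: complex_ext; rewrite !ReImE /=; last by ring.
    transitivity (- (Num.sqrt 3 ^+ 2 / 9) : R); first by field.
    by rewrite t2; field.
  transitivity (c * c * (3 * (c * (v - w)))); first by ring.
  by rewrite cw c2 mulrN1 mulrNN h3.
(* The entry is c w^(ij), the exponent ij being taken modulo 3. *)
pose M : 'M[R[i]]_3 := \matrix_(i, j)
  (c * (if i * j == 0 then 1 else if i == j then w else v)).
have uM : su3_pred M.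
  apply/andP; split; last first.
    rewrite det_mx33 !mxE /= -[X in _ == X]c3; apply/eqP.
    transitivity (c * c * c * (w * w - v * v + 2 * (v - w))); first by ring.
    by rewrite ww vv; ring.
  apply/unitarymxP/matrixP => i j; rewrite !mxE sum_ord3 !mxE.
  have E (x1 y1 x2 y2 x3 y3 : R[i]) : c * x1 * Num.conj (c * y1) +
    c * x2 * Num.conj (c * y2) + c * x3 * Num.conj (c * y3) =
    (3^-1)%:C * (x1 * Num.conj y1 + x2 * Num.conj y2 + x3 * Num.conj y3).
    by rewrite -cc !rmorphM /=; ring.
  rewrite E; elim/ord3_ind: i; elim/ord3_ind: j => /=;
    rewrite ?rmorph1 ?conjCK -/v ?mulr1 ?mul1r ?(mulrC v w) ?wv ?ww ?vv -?[X in _ = X]h3;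
    rewrite ?vE; by [ring|congr (_ * _); ring].
exists (MkSU3 uM) => i j; rewrite /= mxE sqnormM sc -[RHS]mulr1; congr (_ * _).
have s1 : sqnorm (1 : R[i]) = 1 by rewrite /sqnorm /= expr1n expr0n addr0.
by elim/ord3_ind: i; elim/ord3_ind: j; rewrite /= ?sqnormJ.
Qed.

(** Complex conjugation of a flat matrix changes the sign of nu, so one flat matrix yields both
    values. *)
Lemma exists_flag_nu : (exists x : flag R, flag_nu x = nu_max) /\
  (exists x : flag R, flag_nu x = - nu_max).
Proof.
have [p fp] := exists_flat.
have sp : su3_pred (map_mx Num.conj p).
  have /andP[up /eqP dp] := valP p; apply/andP; split.
    by rewrite conjC_unitary.
  by rewrite det_map_mx dp rmorph1.
pose p' := MkSU3 sp.
have J : jarl p' 0 = - jarl p 0 by rewrite /jarl !mxE !ReImE; ring.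
have nuE : flag_nu (\pi_(flag R) p') = - flag_nu (\pi_(flag R) p).
  by rewrite !(flag_nuE _ 0) J mulrN.
case: (flat_flag_nu _ fp) => e; split.
- by exists (\pi_(flag R) p).
- by exists (\pi_(flag R) p'); rewrite nuE e.
- by exists (\pi_(flag R) p'); rewrite nuE e opprK.
- by exists (\pi_(flag R) p).
Qed.

End TorusOrbits.

Theorem proposition4p3 (R : realType) :
  exists Omax Omin : set (flag R),
    [/\ Omax <> Omin,
        [set torus_orbit x | x in [set x | critical x /\ flag_nu x <> 0]]
          = [set Omax; Omin],
        (forall x y, Omax x -> flag_nu y <= flag_nu x)
      & (forall x y, Omin x -> flag_nu x <= flag_nu y)].
Proof.
have [[x1 nx1] [x2 nx2]] := @exists_flag_nu R.
(* The two orbits are given as the level sets of the extreme values. *)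
exists [set x | flag_nu x = nu_max], [set x | flag_nu x = - nu_max]; split.
- move=> e.
  have nx1' : flag_nu x1 = - nu_max by exact: (eq_ind _ (fun S => S x1) nx1 _ e).
  exact: (nu_max_neqN (etrans (esym nx1) nx1')).
- apply/seteqP; split => [_ [x [cx nx] <-]|_ [->|->]] /=.
  + case: (proj1 (critical_extremal x) (conj cx nx)) => e; [left | right];
      by apply: torus_orbitE e; [left + right].
  + exists x1; first exact: (proj2 (critical_extremal x1) (or_introl nx1)).
    by apply: torus_orbitE nx1; left.
  + exists x2; first exact: (proj2 (critical_extremal x2) (or_intror nx2)).
    by apply: torus_orbitE nx2; right.
- by move=> x y /= ->; have /andP[] := flag_nu_bound y.
- by move=> x y /= ->; have /andP[] := flag_nu_bound y.
Qed.
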